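(* Let $n\geqslant 2$, let $F_n$ be the free group with basis $x_1,\dots,x_n$, and let $H=\langle x_1,\dots ,x_n\,|\, R_1,\dots ,R_m\rangle$ be a finite, concise and Peiffer aspherical presentation. Let $$M(H)=\{(w_1,w_2)\in F_n\times F_n \mid w_1=_H w_2\}\leqslant F_n\times F_n .$$ Then $M(H)$ admits the following presentation $$\big\langle d_1,\dots ,d_n, t_1,\dots ,t_m\, \mid \, [t_j, d^{-1}t_i^{-1}r_i \,d],\ [t_i, \mathrm{root}(r_i)]\quad (1\leqslant i,j\leqslant m,\ d\in D_n)\big\rangle,$$ where $D_n$ is the free group with basis $d_1,\dots ,d_n$, where $r_i$ denotes the word in $D_n$ obtained from $R_i$ by replacing each $x_k$ by $d_k$, and where $\mathrm{root}(r_i)$ denotes the unique element $s_i\in D_n$ such that $r_i$ is a positive power of $s_i$ but $s_i$ itself is not a proper power. In this presentation the elements $d_i$ and $t_j$ correspond, respectively, to the elements $(x_i,x_i)$ and $(1,R_j)$ of $M(H)$; that is, the assignment $d_i\mapsto (x_i,x_i)$ ($1\leqslant i\leqslant n$), $t_j\mapsto (1,R_j)$ ($1\leqslant j\leqslant m$) induces an isomorphism from the group given by this presentation onto $M(H)$.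
   Context: $H$ denotes both the presentation and the group it presents (a quotient of $F_n$); $w_1=_H w_2$ means that $w_1,w_2\in F_n$ determine the same element of $H$. The relators $R_1,\dots,R_m$ form a finite list of words in the alphabet $\{x_1,\dots,x_n\}^{\pm1}$. Concise: the presentation is concise if every relator $R_i$ is non-trivial and reduced, and every two relators $R_i,R_j$ with $i\neq j$ are not conjugate in $F_n$ to each other or to the inverse of each other. Identity among relations: given $l\geqslant 0$, elements $U_1,\dots,U_l\in F_n$, relators $R_{i_1},\dots,R_{i_l}\in\{R_1,\dots,R_m\}$ and $\varepsilon_1,\dots,\varepsilon_l\in\{-1,1\}$ such that $(U_1R_{i_1}^{\varepsilon_1}U_1^{-1})\cdots(U_lR_{i_l}^{\varepsilon_l}U_l^{-1})=1$ in $F_n$, the sequence $(U_1R_{i_1}^{\varepsilon_1}U_1^{-1},\dots,U_lR_{i_l}^{\varepsilon_l}U_l^{-1})$ of elements of $F_n$ is called an identity among relations of length $l$; for $l=0$ it is the empty identity. Peiffer transformations of an identity among relations: (first kind, exchange) for some $1\leqslant p\leqslant l-1$, replace the two consecutive terms $U_pR_{i_p}^{\varepsilon_p}U_p^{-1}$ and $U_{p+1}R_{i_{p+1}}^{\varepsilon_{p+1}}U_{p+1}^{-1}$ by the two consecutive terms $U_{p+1}R_{i_{p+1}}^{\varepsilon_{p+1}}U_{p+1}^{-1}$ and $(U_{p+1}R_{i_{p+1}}^{-\varepsilon_{p+1}}U_{p+1}^{-1}U_p)R_{i_p}^{\varepsilon_p}(U_p^{-1}U_{p+1}R_{i_{p+1}}^{\varepsilon_{p+1}}U_{p+1}^{-1})$;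 (second kind) deletion: delete two consecutive terms $U_pR_{i_p}^{\varepsilon_p}U_p^{-1}$ and $U_{p+1}R_{i_{p+1}}^{\varepsilon_{p+1}}U_{p+1}^{-1}$ whose product equals $1$ in $F_n$; insertion: the inverse of a deletion. Peiffer aspherical: the presentation is Peiffer aspherical if every identity among relations can be carried to the empty one by a (finite) sequence of Peiffer transformations (exchanges, deletions, insertions). $[a,b]$ denotes the commutator of $a$ and $b$. $D_n$ is regarded as the subgroup generated by $d_1,\dots,d_n$ in the free group on $d_1,\dots,d_n,t_1,\dots,t_m$. *)

(* Defs.v *)
From HB Require Import structures.
From Stdlib Require Import Relation_Operators.
From mathcomp Require Import all_boot.
From mathcomp Require Import boolp classical_sets.

Set Implicit Arguments.
Unset Strict Implicit.
Unset Printing Implicit Defensive.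

Local Open Scope group_scope.
Local Open Scope classical_set_scope.

(* The letter (a, false) stands for a, and (a, true) for its formal inverse. *)
Definition word (A : Type) := seq (A * bool).

Definition inv_letter (A : Type) (l : A * bool) : A * bool := (l.1, ~~ l.2).

Definition inv_word (A : Type) (w : word A) : word A :=
  rev (map (@inv_letter A) w).

Lemma inv_letterK (A : Type) : involutive (@inv_letter A).
Proof. by move=> [a b]; rewrite /inv_letter /= negbK. Qed.

Section FreeGroup.
Variable A : choiceType.
Implicit Types (l : A * bool) (u v w : word A).

Definition reduced w : bool := sorted (fun k l => l != inv_letter k) w.

Definition push l w : word A :=
  if w is k :: w' then if k == inv_letter l then w' else l :: w else [:: l].

Definition reduce w : word A := foldr push [::] w.

Lemma push_reduced l w : reduced w -> reduced (push l w).
Proof.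
case: w => [|k w] //= red_w; case: ifPn => [_|neq]; last by rewrite /= neq.
exact: path_sorted red_w.
Qed.

Lemma foldr_push_reduced u w : reduced w -> reduced (foldr push w u).
Proof. by move=> red_w; elim: u => //= l u; apply: push_reduced. Qed.

Lemma reduce_reduced w : reduced (reduce w).
Proof. exact: foldr_push_reduced. Qed.

Lemma reduce_id w : reduced w -> reduce w = w.
Proof.
elim: w => [|l w IHw] //= red_w.
rewrite IHw; last exact: path_sorted red_w.
by case: w red_w {IHw} => [|k w] //= /andP[/negPf-> _].
Qed.

Lemma pushK l w : reduced w -> push l (push (inv_letter l) w) = w.
Proof.
case: w => [|k w] /=; first by rewrite eqxx.
rewrite inv_letterK; case: eqVneq => [->|_ _] /=; last by rewrite eqxx.
by case: w => [|k' w] //= /andP[/negPf-> _].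
Qed.

Lemma foldr_push_reduce u w : reduced w ->
  foldr push w (reduce u) = foldr push w u.
Proof.
move=> red_w; elim: u => //= l u <-.
case: (reduce u) => [|k v] //=; case: eqP => //= ->.
by rewrite pushK //; apply: foldr_push_reduced.
Qed.

Lemma reduce_catr u v : reduce (u ++ reduce v) = reduce (u ++ v).
Proof. by rewrite /reduce !foldr_cat -/(reduce _) reduce_id ?reduce_reduced. Qed.

Lemma reduce_catl u v : reduce (reduce u ++ v) = reduce (u ++ v).
Proof.
by rewrite /reduce !foldr_cat foldr_push_reduce // reduce_reduced.
Qed.

Lemma inv_wordK : involutive (@inv_word A).
Proof.
move=> w; rewrite /inv_word map_rev revK -map_comp -[RHS]map_id.
by apply: eq_map => l /=; rewrite inv_letterK.
Qed.

Lemma reduce_inv_wordl w : reduce (inv_word w ++ w) = [::].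
Proof.
elim: w => // l w IHw; rewrite /inv_word /= rev_cons cat_rcons -IHw.
rewrite /reduce !foldr_cat /=; congr foldr.
by rewrite -[in push l](inv_letterK l) pushK // reduce_reduced.
Qed.

Definition free_group : Type := {w : word A | reduced w}.

HB.instance Definition _ := Choice.on free_group.

Definition free_of_word w : free_group := exist _ (reduce w) (reduce_reduced w).

Definition free_one : free_group := free_of_word [::].
Definition free_inv (x : free_group) : free_group :=
  free_of_word (inv_word (val x)).
Definition free_mul (x y : free_group) : free_group :=
  free_of_word (val x ++ val y).

Lemma free_mulA : associative free_mul.
Proof.
by move=> x y z; apply: val_inj; rewrite /= reduce_catr reduce_catl catA.
Qed.

Lemma free_mul1 : left_id free_one free_mul.
Proof. by move=> x; apply: val_inj; rewrite /= reduce_id ?(valP x). Qed.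

Lemma free_mulr1 : right_id free_one free_mul.
Proof. by move=> x; apply: val_inj; rewrite /= cats0 reduce_id ?(valP x). Qed.

Lemma free_mulV : left_inverse free_one free_inv free_mul.
Proof.
by move=> x; apply: val_inj; rewrite /= reduce_catl reduce_inv_wordl.
Qed.

Lemma free_mulrV : right_inverse free_one free_inv free_mul.
Proof.
move=> x; apply: val_inj; rewrite /= reduce_catr.
by rewrite -{1}[val x]inv_wordK reduce_inv_wordl.
Qed.

HB.instance Definition _ :=
  isGroup.Build free_group free_mulA free_mul1 free_mulr1 free_mulV free_mulrV.

Definition free_gen (a : A) : free_group := free_of_word [:: (a, false)].

End FreeGroup.

Section Presentation.

Definition subgroup (G : groupType) (N : set G) : Prop :=
  [/\ N 1, forall x y, N x -> N y -> N (x * y) & forall x, N x -> N x^-1].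

Definition normal_subgroup (G : groupType) (N : set G) : Prop :=
  subgroup N /\ forall x g, N x -> N (x ^ g).

Definition generated (G : groupType) (S : set G) : set G :=
  smallest (@subgroup G) S.

Definition normal_closure (G : groupType) (S : set G) : set G :=
  smallest (@normal_subgroup G) S.

Lemma normal_closure_normal (G : groupType) (S : set G) :
  normal_subgroup (normal_closure S).
Proof.
split; first split.
- by move=> N [[[N1 _ _] _] _]; apply: N1.
- move=> x y Nx Ny N NP; have [[[_ NM _] _] _] := NP.
  by apply: NM; [apply: Nx | apply: Ny].
- by move=> x Nx N NP; have [[[_ _ NV] _] _] := NP; apply: NV; apply: Nx.
- by move=> x g Nx N NP; have [[_ NJ] _] := NP; apply: NJ; apply: Nx.
Qed.

Variables (A : choiceType) (S : set (free_group A)).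

Definition pres_rel (x y : free_group A) : bool :=
  `[< normal_closure S (x^-1 * y) >].

Lemma pres_rel_refl : reflexive pres_rel.
Proof.
by move=> x; apply/asboolP; rewrite mulVg; have [[]] := normal_closure_normal S.
Qed.

Lemma pres_rel_imp x y : pres_rel x y -> pres_rel y x.
Proof.
move=> /asboolP Nxy; apply/asboolP; have [[_ _ NV] _] := normal_closure_normal S.
by have := NV _ Nxy; rewrite invgM invgK.
Qed.

Lemma pres_rel_sym : symmetric pres_rel.
Proof. by move=> x y; apply/idP/idP; apply: pres_rel_imp. Qed.

Lemma pres_rel_trans : transitive pres_rel.
Proof.
move=> y x z /asboolP Nxy /asboolP Nyz; apply/asboolP.
have [[_ NM _] _] := normal_closure_normal S.
by have := NM _ _ Nxy Nyz; rewrite mulgA mulgK.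
Qed.

Canonical pres_equiv :=
  EquivRel pres_rel pres_rel_refl pres_rel_sym pres_rel_trans.

(* The group < A | S >: the quotient of the free group on A by the normal
   closure of S. *)
Definition presented : Type := {eq_quot pres_equiv}%qT.

HB.instance Definition _ := Choice.on presented.
HB.instance Definition _ := EqQuotient.on presented.

Definition pres_class (x : free_group A) : presented := (\pi_presented x)%qT.

Lemma pres_classP x y :
  pres_class x = pres_class y <-> normal_closure S (x^-1 * y).
Proof.
rewrite /pres_class.
by split=> [/eqquotP/asboolP | ?]; last exact/eqquotP/asboolP.
Qed.

Definition pres_one : presented := pres_class 1.
Definition pres_inv (p : presented) : presented := pres_class (repr p)^-1.
Definition pres_mul (p q : presented) : presented :=
  pres_class (repr p * repr q).

Lemma pres_classK p : pres_class (repr p) = p.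
Proof. exact: reprK. Qed.

Lemma pres_class_repr x : normal_closure S ((repr (pres_class x))^-1 * x).
Proof. by apply/pres_classP; rewrite pres_classK. Qed.

Lemma pres_classM x y :
  pres_mul (pres_class x) (pres_class y) = pres_class (x * y).
Proof.
apply/pres_classP; set x' := repr _; set y' := repr _.
have [[_ NM _] NJ] := normal_closure_normal S.
have := NM _ _ (NJ _ y' (pres_class_repr x)) (pres_class_repr y).
by rewrite -/x' -/y' /conjg invgM !mulgA mulgK.
Qed.

Lemma pres_classV x : pres_inv (pres_class x) = pres_class x^-1.
Proof.
apply/pres_classP; set x' := repr _; rewrite invgK.
have [[_ _ NV] NJ] := normal_closure_normal S.
have := NJ _ x'^-1 (NV _ (pres_class_repr x)).
by rewrite -/x' /conjg invgM !invgK !mulgA mulgK.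
Qed.

Lemma pres_mulA : associative pres_mul.
Proof.
move=> p q r; rewrite -(pres_classK p) -(pres_classK q) -(pres_classK r).
by rewrite !pres_classM mulgA.
Qed.

Lemma pres_mul1 : left_id pres_one pres_mul.
Proof. by move=> p; rewrite -(pres_classK p) pres_classM mul1g. Qed.

Lemma pres_mulr1 : right_id pres_one pres_mul.
Proof. by move=> p; rewrite -(pres_classK p) pres_classM mulg1. Qed.

Lemma pres_mulV : left_inverse pres_one pres_inv pres_mul.
Proof. by move=> p; rewrite -(pres_classK p) pres_classV pres_classM mulVg. Qed.

Lemma pres_mulrV : right_inverse pres_one pres_inv pres_mul.
Proof. by move=> p; rewrite -(pres_classK p) pres_classV pres_classM mulgV. Qed.

HB.instance Definition _ :=
  isGroup.Build presented pres_mulA pres_mul1 pres_mulr1 pres_mulV pres_mulrV.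

Lemma pres_class_morphism : monoid_morphism pres_class.
Proof. by split=> // x y; rewrite -pres_classM. Qed.

HB.instance Definition _ :=
  isUMagmaMorphism.Build (free_group A) presented pres_class
    pres_class_morphism.

End Presentation.

Section Relators.
Variables n m : nat.
Variable R : 'I_m -> word 'I_n.

Local Notation F := (free_group 'I_n).

Definition relator (i : 'I_m) : F := free_of_word (R i).

Definition group_of : groupType := presented (range relator).

Definition eq_in_group (w1 w2 : F) : bool :=
  (pres_class (range relator) w1 : group_of) == pres_class (range relator) w2.

Definition concise : Prop :=
  (forall i, relator i <> 1 /\ reduced (R i)) /\
  (forall i j g, i <> j ->
     relator j <> relator i ^ g /\ relator j <> (relator i)^-1 ^ g).

(* The exponent -1 is encoded by true. *)
Definition signed (e : bool) (x : F) : F := if e then x^-1 else x.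

Definition conj_relator (U : F) (i : 'I_m) (e : bool) : F :=
  U * signed e (relator i) * U^-1.

Definition is_identity (s : seq F) : Prop :=
  (forall x, x \in s -> exists U i e, x = conj_relator U i e) /\
  \prod_(x <- s) x = 1.

Inductive peiffer_step : seq F -> seq F -> Prop :=
| Peiffer_exchange s1 s2 U i e V j f :
    peiffer_step
      (s1 ++ conj_relator U i e :: conj_relator V j f :: s2)
      (s1 ++ conj_relator V j f ::
        (V * signed (~~ f) (relator j) * V^-1 * U) *
        signed e (relator i) *
        (U^-1 * V * signed f (relator j) * V^-1) :: s2)
| Peiffer_deletion s1 s2 U i e V j f :
    conj_relator U i e * conj_relator V j f = 1 ->
    peiffer_step
      (s1 ++ conj_relator U i e :: conj_relator V j f :: s2) (s1 ++ s2)
| Peiffer_insertion s1 s2 U i e V j f :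
    conj_relator U i e * conj_relator V j f = 1 ->
    peiffer_step
      (s1 ++ s2) (s1 ++ conj_relator U i e :: conj_relator V j f :: s2).

Definition peiffer_aspherical : Prop :=
  forall s, is_identity s -> clos_refl_trans _ peiffer_step s [::].

Definition in_mihailova : {pred F * F} := fun w => eq_in_group w.1 w.2.

Definition mihailova : Type := {w : F * F | in_mihailova w}.

Lemma in_mihailova_group : group_closed in_mihailova.
Proof.
split=> [|[x1 x2] [y1 y2]]; rewrite /in_mihailova /eq_in_group !unfold_in /=.
  exact: eqxx.
move=> /eqP eqx /eqP eqy; rewrite !gmulfF /=.
by apply/eqP; congr (_ / _).
Qed.

HB.instance Definition _ := SubChoice.on mihailova.
HB.instance Definition _ :=
  SubChoice_isSubGroup.Build _ _ mihailova in_mihailova_group.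

(* The ambient free group, on d_1, ..., d_n and t_1, ..., t_m. *)
Local Notation E := (free_group ('I_n + 'I_m)%type).

Definition d_ (k : 'I_n) : E := free_gen (inl k).
Definition t_ (i : 'I_m) : E := free_gen (inr i).

Definition D_ : set E := generated (range d_).

Definition r_ (i : 'I_m) : E :=
  free_of_word [seq (inl l.1, l.2) | l <- R i].

Definition is_root (x s : E) : Prop :=
  [/\ D_ s, exists k, x = s ^+ k.+1 &
      ~ exists u k, [/\ D_ u, (1 < k)%N & s = u ^+ k]].

(* Every nontrivial x in D_ has exactly one root, which is what is selected;
   xget returns 1 when there is none. *)
Definition root_of (x : E) : E := xget 1 (is_root x).

Definition mihailova_relators : set E :=
  [set x | (exists i j d, D_ d /\ x = [~ t_ j, d^-1 * (t_ i)^-1 * r_ i * d]) \/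
           (exists i, x = [~ t_ i, root_of (r_ i)])].

Definition mihailova_presented : groupType := presented mihailova_relators.

End Relators.

(* Main.v *)
(* The first projection splits M(H) as the semidirect product of the diagonal
   copy of F_n and the normal closure N of the relators; the presented group P
   likewise splits over D_n, with a kernel K generated by the conjugates
   U t_i^e U^-1, U in D_n.  So it must be shown that K -> N is injective.
   The map sending the element U R_i^e U^-1 of F_n to U t_i^e U^-1 in P is well
   defined: by conciseness the element determines i and e (in a free group,
   x <> 1 is not conjugate to x^-1), and it determines U up to the centralizer
   of R_i, which is generated by root(R_i), and root(r_i) commutes with t_i in P.
   The other relators say that t_i^d and r_i^d act alike on the t_j, so the
   product of the values of this map along a sequence is invariant under Peiffer
   exchanges; it is plainly invariant under deletions and insertions.  A product
   of conjugates that is 1 in F_n is an identity among relations, hence can be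
   carried to the empty one, so the corresponding product in P is 1. *)

From HB Require Import structures.
From Stdlib Require Import Relation_Operators.
Require Import Defs.
From mathcomp Require Import all_boot.
From mathcomp Require Import boolp classical_sets.

Local Open Scope group_scope.

Set Implicit Arguments.
Unset Strict Implicit.
Unset Printing Implicit Defensive.

(** * Commuting words in a free monoid *)

Section CommutingWords.
Variable T : eqType.
Implicit Types u v w x p : seq T.

Definition word_pow k w : seq T := iter k (cat w) [::].

Lemma cat_word_powC N v x : v ++ x = x ++ v ->
  v ++ word_pow N x = word_pow N x ++ v.
Proof.
move=> comm_vx; elim: N => /= [|N IHN]; first by rewrite cats0.
by rewrite catA comm_vx -!catA IHN.
Qed.

(** As [v] commutes with every power of [x], it is a prefix of [word_pow N x ++ v], hence of the
    power alone once that is long enough. *)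
Lemma commuting_word_take N v x : v ++ x = x ++ v ->
  (size v <= size (word_pow N x))%N -> v = take (size v) (word_pow N x).
Proof.
move=> comm_vx le_v.
rewrite -{1}(take_size_cat (word_pow N x) (erefl (size v))).
by rewrite cat_word_powC // takel_cat.
Qed.

Lemma size_word_pow k w : size (word_pow k w) = (k * size w)%N.
Proof. by elim: k => //= k IHk; rewrite size_cat IHk mulSn. Qed.

(* A word commuting with [x] is a prefix of a power of [x]; the generator is the
   shortest non-empty such word, which can be split off all the others. *)
Lemma commuting_word_generator x : x != [::] ->
  exists p, forall v, v ++ x = x ++ v -> exists k, v = word_pow k p.
Proof.
move=> x_neq0.
pose P k := (0 < k) && `[< exists2 p, size p = k & p ++ x = x ++ p >].
have exP : exists k, P k.
  exists (size x); rewrite /P lt0n size_eq0 x_neq0 /=.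
  by apply/asboolP; exists x.
case: (ex_minnP exP) => k /andP[k_gt0 /asboolP[p size_p comm_px]] min_k.
exists p => v; have [N] := ubnP (size v); elim: N v => // N IHN v le_vN comm_vx.
have [v0|v_neq0] := eqVneq v [::]; first by exists 0%N.
have le_pv : size p <= size v.
  rewrite size_p min_k // /P lt0n size_eq0 v_neq0.
  by apply/asboolP; exists v.
have le_vx : size v <= size (word_pow (size v) x).
  by rewrite size_word_pow leq_pmulr // lt0n size_eq0.
(* Both words are prefixes of one power of [x], so the shorter is a prefix of the longer. *)
have pE : p = take (size p) v.
  rewrite {1}(commuting_word_take comm_px (leq_trans le_pv le_vx)).
  by rewrite [in RHS](commuting_word_take comm_vx le_vx) take_takel.
have vE : v = p ++ drop (size p) v by rewrite {1}pE cat_take_drop.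
case: (IHN (drop (size p) v)).
- rewrite size_drop; apply: leq_trans (_ : size v <= N) => //.
  by rewrite ltn_subrL size_p k_gt0 (leq_trans _ le_pv) // size_p.
- set v' := drop _ _ in vE *; have: p ++ (v' ++ x) = p ++ (x ++ v').
    by rewrite catA -vE comm_vx vE !catA comm_px.
  by move/(congr1 (drop (size p))); rewrite !drop_size_cat.
by move=> j dropE; exists j.+1; rewrite vE dropE.
Qed.

End CommutingWords.

(** * Torsion, centralizers and roots in free groups *)

Definition indivisible (G : groupType) (s : G) :=
  ~ exists (u : G) k, (1 < k)%N /\ s = u ^+ k.

Lemma commuteXV (G : groupType) (a p : G) k :
  commute a p -> commute a (p ^+ k) /\ commute a (p ^- k).
Proof. by move=> ap; split; last apply: commuteV; apply: commuteX. Qed.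

Section FreeGroupTheory.
Variable A : choiceType.
Implicit Types (u v w : word A) (x y g s p : free_group A).

Local Notation free_of_word := (@free_of_word A).

Lemma val_freeK : cancel val free_of_word.
Proof. by move=> x; apply: val_inj; rewrite /= reduce_id ?(valP x). Qed.

Lemma free_of_word_cat u v :
  free_of_word (u ++ v) = free_of_word u * free_of_word v.
Proof. by apply: val_inj; rewrite /= reduce_catr reduce_catl. Qed.

Lemma free_of_word_inv w : free_of_word (inv_word w) = (free_of_word w)^-1.
Proof.
rewrite -[RHS]mul1g; have <- : free_of_word (inv_word w ++ w) = 1.
  by apply: val_inj; rewrite /= reduce_inv_wordl.
by rewrite free_of_word_cat mulgK.
Qed.

Lemma free_of_word_pow k w :
  free_of_word (word_pow k w) = free_of_word w ^+ k.
Proof. by elim: k => //= k IHk; rewrite free_of_word_cat IHk expgS. Qed.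

Lemma reduced_cat_cons u v (a b : A * bool) :
  reduced (rcons u a ++ b :: v) =
  [&& reduced (rcons u a), b != inv_letter a & reduced (b :: v)].
Proof.
by case: u => [|c u] //=; rewrite cat_path last_rcons.
Qed.

Lemma reduced_cat_overlap u v w : u != [::] ->
  reduced (w ++ u) -> reduced (u ++ v) -> reduced (w ++ u ++ v).
Proof.
case: u => // a u _ /=; rewrite /reduced !sorted_cat_cons => /andP[-> _].
by [].
Qed.

Lemma reduced_inv_word w : reduced (inv_word w) = reduced w.
Proof.
rewrite /reduced /inv_word rev_sorted sorted_map; apply: eq_sorted => a b /=.
by rewrite inv_letterK eq_sym.
Qed.

Lemma size_push l w : size (push l w) <= (size w).+1.
Proof.
by case: w => //= k w; case: ifP => // _ /=; rewrite -addn2 leq_addr.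
Qed.

Lemma size_reduce w : size (reduce w) <= size w.
Proof. by elim: w => //= l w IHw; apply: leq_trans (size_push _ _) _. Qed.

(** Each [push] either adds one letter or cancels one, so equal lengths mean that nothing was
    cancelled. *)
Lemma reduce_size_eq w : size (reduce w) = size w -> reduce w = w.
Proof.
elim: w => //= l w IHw size_lw.
have redw : reduce w = w.
  apply: IHw; apply/eqP; rewrite eqn_leq size_reduce -ltnS -size_lw size_push.
  by [].
move: size_lw; rewrite redw; case: w {IHw redw} => //= k w.
case: ifP => // _ /eqP; rewrite -[X in X == _]addn0 -addn2 eqn_add2l.
by [].
Qed.

(** The two concatenations have the same length and the same reduced form, so if one is reduced, so
    is the other. This turns commutation in the group into commutation of words. *)
Lemma commuting_reduced_cat x y : commute x y ->
  reduced (val x ++ val y) -> val y ++ val x = val x ++ val y.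
Proof.
move=> /(congr1 val) /= comm_xy red_xy; rewrite reduce_id // in comm_xy.
by rewrite comm_xy reduce_size_eq // -comm_xy !size_cat addnC.
Qed.

(** A cancellation in [u ++ v] makes the first letter of [v] inverse to the last letter of [u]; one
    in [inv_word v ++ u] makes it equal to the first letter of [u]. Both together contradict
    [reduced (u ++ u)]. *)
Lemma cyclically_reduced_cat (u v : word A) : u != [::] -> reduced (u ++ u) ->
  reduced v -> reduced (u ++ v) || reduced (inv_word v ++ u).
Proof.
move=> u_neq0 red_uu red_v.
have red_u : reduced u by case: (cat_sorted2 red_uu).
case: v red_v => [|c v] red_v; first by rewrite cats0 red_u.
have [b [u' ub]] : exists b u', u = rcons u' b.
  by case/lastP: u u_neq0 {red_uu red_u} => // u' b _; exists b, u'.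
have [a [u'' ua]] : exists a u'', u = a :: u''.
  by case: u u_neq0 {red_uu red_u ub} => // a u'' _; exists a, u''.
have: a != inv_letter b.
  by move: red_uu; rewrite {1}ub {1}ua reduced_cat_cons => /and3P[].
rewrite {1}ub reduced_cat_cons -ub red_u red_v andbT /=.
rewrite /inv_word /= rev_cons {1}ua reduced_cat_cons -ua red_u inv_letterK.
rewrite -rev_cons -[_ :: map _ _]/(map _ (c :: v)) -/(inv_word (c :: v)).
rewrite reduced_inv_word red_v andbT /=.
by have [->|] := eqVneq c (inv_letter b).
Qed.

(** Induction on length: as long as the first and last letters are mutually inverse, a conjugation
    strips them off. *)
Lemma cyclically_reduced_conj x : x != 1 ->
  exists y g, [/\ x = y ^ g, val y != [::] & reduced (val y ++ val y)].
Proof.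
rewrite -{1 2}[x]val_freeK; have [N] := ubnP (size (val x)).
elim: N (val x) (valP x) => // N IHN w red_w le_wN w_neq1.
have w_neq0 : w != [::] by apply: contraNneq w_neq1 => ->.
have [red_ww|nred_ww] := boolP (reduced (w ++ w)).
  by exists (free_of_word w), 1; rewrite conjg1 /= reduce_id.
case: w red_w le_wN w_neq1 w_neq0 nred_ww => // a w red_w le_wN w_neq1 _.
case/lastP: w red_w le_wN w_neq1 => [|w b] red_w le_wN w_neq1.
  by case: a {red_w le_wN w_neq1} => a [] /=; rewrite andbT /eq_op /= andbF.
rewrite -{1}rcons_cons reduced_cat_cons red_w andbT /= negbK => /eqP aE.
have wE : free_of_word (a :: rcons w b) = free_of_word w ^ free_of_word [:: b].
  by rewrite conjgE -free_of_word_inv -(free_of_word_cat w) -free_of_word_cat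
             cats1 aE.
have [|||y [g [yE y_neq0 red_yy]]] := IHN w.
- by move: red_w; rewrite /= -cats1 => /path_sorted /cat_sorted2[].
- by rewrite -ltnS (leq_trans _ le_wN) //= size_rcons !ltnS.
- by apply: contraNneq w_neq1 => w1; rewrite wE w1 conj1g.
by exists y, (g * free_of_word [:: b]); rewrite conjgM -yE -wE.
Qed.

(** Powers of a cyclically reduced word involve no cancellation. *)
Lemma free_torsion_free x k : x != 1 -> x ^+ k.+1 != 1.
Proof.
move=> /cyclically_reduced_conj[y [g [-> y0 red_yy]]].
rewrite -conjXg conjg_eq1 -[y]val_freeK -free_of_word_pow.
set v := val y in y0 red_yy *.
suff red_pow : reduced (word_pow k.+1 v).
  apply: contraNneq y0 => /(congr1 val); rewrite /= reduce_id //.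
  by case: (v).
elim: k => [|k IHk]; first by rewrite /= cats0; case: (cat_sorted2 red_yy).
exact: reduced_cat_overlap IHk.
Qed.

(** Conjugate [x] to a cyclically reduced [y]. Any element commuting with [y], or its inverse,
    concatenates with [y] without cancellation, so it commutes with [y] as a word and is a power of
    the generator of the commuting words. *)
Lemma centralizer_cyclic x : x != 1 ->
  exists2 p, exists k, x = p ^+ k.+1 &
  forall g, commute g x -> exists k, g = p ^+ k \/ g = p ^- k.
Proof.
move=> /cyclically_reduced_conj[y [h [xE y0 red_yy]]].
have [p genp] := commuting_word_generator y0.
have gen_p g : val g ++ val y = val y ++ val g ->
    exists k, g = free_of_word p ^+ k.
  move=> /genp[k gE]; exists k; rewrite -free_of_word_pow -gE.
  by rewrite val_freeK.
exists (free_of_word p ^ h).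
  have [[|k] yE] := gen_p y erefl; last by exists k; rewrite xE {1}yE conjXg.
  by rewrite yE in y0.
move=> g comm_gx; have comm_gy : commute y (g ^ h^-1).
  apply: (conjg_inj h); rewrite /= (conjMg y) (conjMg _ y) conjgKV -xE.
  exact/commute_sym.
case/orP: (cyclically_reduced_cat y0 red_yy (valP (g ^ h^-1))) => red_cat.
  have [k gE] := gen_p _ (commuting_reduced_cat comm_gy red_cat).
  by exists k; left; rewrite -conjXg -gE conjgKV.
have red_inv : val (g ^ h^-1)^-1 = inv_word (val (g ^ h^-1)).
  by rewrite /= reduce_id // reduced_inv_word (valP (g ^ h^-1)).
rewrite -red_inv in red_cat.
have comm_gVy := commute_sym (commuteV comm_gy).
have [k gE] := gen_p _ (esym (commuting_reduced_cat comm_gVy red_cat)).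
exists k; right; rewrite -conjXg -gE.
by rewrite conjVg invgK conjgKV.
Qed.

Lemma free_commute_trans x y z :
  y != 1 -> commute x y -> commute z y -> commute x z.
Proof.
move=> /centralizer_cyclic[p _ gen_p] /gen_p[k xE] /gen_p[j zE].
have px : commute p x by case: xE => ->; case: (commuteXV k (commute_refl p)).
apply: commute_sym.
have [] := commuteXV j (commute_sym px).
by case: zE => -> ? ?; apply: commute_sym.
Qed.

(** If [x ^ g = x^-1], then [g ^+ 2] commutes with [x] and with [g]. By transitivity of commutation
    [x] commutes with [g], so [x ^+ 2 = 1], against the absence of torsion. *)
Lemma free_conj_neq_inv x g : x != 1 -> x ^ g != x^-1.
Proof.
move=> x_neq1; apply/negP => /eqP xgE.
have x2_neq1 : x ^+ 2 != 1 by apply: free_torsion_free.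
suff /eqP : x ^ g = x by rewrite xgE eq_sym -mulg_eq1 (negPf x2_neq1).
have [g1|g_neq1] := eqVneq g 1; first by rewrite g1 conjg1.
have comm_g : commute g (g ^+ 2) by apply/commuteX/commute_refl.
have comm_x : commute x (g ^+ 2).
  by apply/commgP; rewrite -conjg_fix expg2 conjgM xgE conjVg xgE invgK.
have /free_commute_trans/(_ comm_x comm_g)/commgP := free_torsion_free 1 g_neq1.
by rewrite -conjg_fix => /eqP.
Qed.

(** The generator [p] of the centralizer of [x] serves: if [p = u ^+ j], then [u] lies in that
    centralizer too, so it is a power of [p], and comparing exponents makes [p] a torsion element
    unless [j] is 1. *)
Lemma primitive_root_exists x : x != 1 ->
  exists s k, x = s ^+ k.+1 /\ indivisible s.
Proof.
move=> x_neq1; have [p [k xE] gen_p] := centralizer_cyclic x_neq1.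
exists p, k; split=> // -[u [j [j_gt1 pE]]].
have p_neq1 : p != 1 by apply: contraNneq x_neq1 => p1; rewrite xE p1 expg1n.
have [c uE] : exists c, u = p ^+ c \/ u = p ^- c.
  by apply: gen_p; rewrite xE pE -expgnA; apply/commuteX/commute_refl.
have pow_neq1 i : p ^+ i.+1 <> 1 by apply/eqP/free_torsion_free.
case: uE => uE; move: pE; rewrite uE.
  case: c {uE} => [|c]; rewrite ?expg1n => pE.
    by rewrite pE eqxx in p_neq1.
  case: j j_gt1 pE => [|[|j]] // _ pE.
  apply: (pow_neq1 (j + c * j.+2)%N); apply: (mulgI p).
  by rewrite -expgS mulg1 [RHS]pE -expgnA.
rewrite expVgn -expgnA => pE; apply: (pow_neq1 (c * j)%N).
by rewrite expgS {1}pE mulVg.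
Qed.

(** The element [s] is a power of the generator [p] of the centralizer. Exponent 0 would give
    [x = 1], and an absolute value of 2 or more would make [s] a proper power, so [s] is [p] or
    [p^-1]. *)
Lemma centralizer_primitive_root x s k g : x != 1 -> x = s ^+ k.+1 ->
  indivisible s -> commute g x -> exists j, g = s ^+ j \/ g = s ^- j.
Proof.
move=> x_neq1 xE prim_s; have [p _ gen_p] := centralizer_cyclic x_neq1.
have [c sE] : exists c, s = p ^+ c \/ s = p ^- c.
  by apply: gen_p; rewrite xE; apply/commuteX/commute_refl.
move=> /gen_p[j gE]; exists j; move: c sE => [|[|c]] sE.
- move: x_neq1; rewrite xE.
  by case: sE => ->; rewrite ?expVgn expg1n ?invg1 eqxx.
- case: sE => ->; rewrite !expg1 ?expVgn ?invgK.
    by case: gE; [left | right].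
  by case: gE; [right | left].
case: prim_s; case: sE => ->; first by exists p, c.+2.
by exists p^-1, c.+2; rewrite expVgn.
Qed.

End FreeGroupTheory.

(** * Universal properties of free groups and of presentations *)

Local Notation hom := UMagmaMorphism.type.

Section UniversalProperties.
Variables (A : choiceType) (G : groupType).

Lemma free_group_ind (P : free_group A -> Prop) : P 1 ->
  (forall a x, P x -> P (free_gen a * x)) ->
  (forall a x, P x -> P ((free_gen a)^-1 * x)) -> forall x, P x.
Proof.
move=> P1 Pgen PgenV x; rewrite -[x]val_freeK.
elim: (val x) => [|[a b] w IHw]; first by [].
rewrite -cat1s free_of_word_cat; case: b; last exact: Pgen.
by rewrite -[[:: _]]/(inv_word [:: (a, false)]) free_of_word_inv; apply: PgenV.
Qed.

Lemma free_universal (h : A -> G) :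
  exists f : hom (free_group A) G,
    forall a, f (free_gen a) = h a.
Proof.
pose hl (l : A * bool) := if l.2 then (h l.1)^-1 else h l.1.
have hlV l : hl (inv_letter l) = (hl l)^-1.
  by case: l => a []; rewrite /hl //= invgK.
(* Evaluating words letter by letter is insensitive to cancellation, which makes [f] below
   multiplicative. *)
have hl_reduce w : \prod_(l <- reduce w) hl l = \prod_(l <- w) hl l.
  elim: w => //= l w IHw; rewrite big_cons -IHw.
  case: (reduce w) => [|k v] /=; first by rewrite big_seq1 big_nil mulg1.
  case: eqP => [->|_]; last by rewrite big_cons.
  by rewrite big_cons hlV mulVKg.
pose f (x : free_group A) := \prod_(l <- val x) hl l.
have fM : {morph f : x y / x * y}.
  by move=> x y; rewrite /f /= hl_reduce big_cat.
have f1 : f 1 = 1 by rewrite /f /= big_nil.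
pose fm := isUMagmaMorphism.Build _ _ f (pair f1 fM).
pose F : hom (free_group A) G := HB.pack f fm.
by exists F => a; rewrite /= /f /= big_seq1.
Qed.

Variable S : set (free_group A).

Lemma pres_class_eq1 x : S x -> pres_class S x = 1.
Proof.
move=> Sx; apply/esym/pres_classP; rewrite invg1 mul1g.
by move=> N [_ sSN]; apply: sSN.
Qed.

Lemma pres_universal (f : hom (free_group A) G) :
  (forall x, S x -> f x = 1) ->
  exists g : hom (presented S) G,
    forall x, g (pres_class S x) = f x.
Proof.
move=> fS1.
have f_closure x : normal_closure S x -> f x = 1.
  move=> cl_x; apply: (cl_x [set y | f y = 1]%classic).
  split=> //; split; [split|] => /=.
  - exact: gmulf1.
  - by move=> y z fy fz; rewrite gmulfM fy fz mulg1.
  - by move=> y fy; rewrite gmulfV fy invg1.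
  - by move=> y z fy; rewrite gmulfJ fy conj1g.
pose g (p : presented S) := f (repr p).
have gE x : g (pres_class S x) = f x.
  have := f_closure _ (pres_class_repr x).
  by rewrite gmulfM gmulfV => /mulg1_eq; rewrite invgK.
have gM : {morph g : p q / p * q}.
  move=> p q; rewrite -(pres_classK p) -(pres_classK q).
  by rewrite -gmulfM !gE gmulfM.
have g1 : g 1 = 1 by apply: etrans (gE 1) gmulf1.
pose gm := isUMagmaMorphism.Build _ _ g (pair g1 gM).
pose g' : hom (presented S) G := HB.pack g gm.
by exists g'.
Qed.

End UniversalProperties.

(** * Lifting conjugates of relators, and the crossed module argument *)

Lemma commuteJ (G : groupType) (x y g : G) :
  commute x y -> commute (x ^ g) (y ^ g).
Proof. by rewrite /commute -!conjMg => ->. Qed.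

Section CrossedModule.
Variables (n m : nat) (R : 'I_m -> word 'I_n).
Local Notation F := (free_group 'I_n).
Local Notation rel := (relator R).

Hypothesis R_concise : concise R.

Lemma relator_neq1 i : rel i != 1.
Proof. by apply/eqP; case: R_concise => /(_ i)[]. Qed.

Lemma conj_relatorE U i e : conj_relator R U i e = signed e (rel i) ^ U^-1.
Proof. by rewrite conjgE invgK mulgA. Qed.

Lemma conj_relatorV U i e :
  (conj_relator R U i e)^-1 = conj_relator R U i (~~ e).
Proof.
by rewrite /conj_relator !invgM invgK mulgA; case: e => /=; rewrite ?invgK.
Qed.

(** The equality makes [rel j] conjugate to [rel i] or, when the signs differ, to its inverse.
    Conciseness gives [i = j]; differing signs would then make [rel i] conjugate to its own
    inverse. *)
Lemma conj_relator_inj U V i j e f :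
  conj_relator R U i e = conj_relator R V j f ->
  [/\ i = j, e = f & commute (V^-1 * U) (rel i)].
Proof.
move=> eqUV; have relE : rel j = signed (e (+) f) (rel i) ^ (U^-1 * V).
  have {eqUV} : signed f (rel j) = signed e (rel i) ^ (U^-1 * V).
    rewrite conjgE invgM invgK !mulgA; apply: (mulIg V^-1); apply: (mulgI V).
    by rewrite !mulgA mulgK mulgV mul1g -[LHS]/(conj_relator R V j f) -eqUV.
  case: f => /=; last by move=> ->; rewrite addbF.
  rewrite addbT => /(congr1 (@inv _)); rewrite invgK -conjVg => ->.
  by case: (e); rewrite /= ?invgK.
have eq_ij : i = j.
  apply/eqP/negP => /negP/eqP neq_ij.
  have [_ /(_ i j (U^-1 * V) neq_ij)[]] := R_concise.
  by move: relE; case: (e (+) f).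
move: relE; rewrite -eq_ij; case: (altP (e =P f)) => [-> | neq_ef].
  rewrite addbb /= => relE; split=> //.
  have -> : V^-1 * U = (U^-1 * V)^-1 by rewrite invgM invgK.
  apply/commute_sym/commuteV/commgP; rewrite -conjg_fix.
  by rewrite -relE.
have -> : e (+) f = true by move: neq_ef; case: (e); case: (f).
rewrite /= conjVg => relE.
have /eqP[] := free_conj_neq_inv (U^-1 * V) (relator_neq1 i).
by rewrite {2}relE invgK.
Qed.

(** [P] abstracts the presented group, [D] the diagonal copy of [F] in it and [T] the generators
    [t_]. [T_peiffer] is the first family of relators; [T_centralizer] is the second, extended from
    the root to the whole centralizer. *)
Variables (P : groupType) (D : hom F P) (T : 'I_m -> P).
Hypothesis T_peiffer : forall i j x,
  commute (T j) ((D x)^-1 * (T i)^-1 * D (rel i) * D x).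
Hypothesis T_centralizer : forall i x,
  commute x (rel i) -> commute (D x) (T i).

Definition conj_gen (U : F) (i : 'I_m) (e : bool) : P :=
  D U * (if e then (T i)^-1 else T i) * (D U)^-1.

Lemma conj_gen_eq U V i j e f :
  conj_relator R U i e = conj_relator R V j f ->
  conj_gen U i e = conj_gen V j f.
Proof.
move=> /conj_relator_inj[<- <- /T_centralizer].
rewrite gmulfM gmulfV /conj_gen => commT.
have {commT} : commute ((D V)^-1 * D U) (if e then (T i)^-1 else T i).
  by case: e => //; apply: commuteV.
move: (if e then _ else _) => t; rewrite /commute => commT.
apply: (mulIg (D U)); apply: (mulgI (D V)^-1); rewrite mulgVK !mulgA commT.
by rewrite mulVg mul1g !mulgA.
Qed.

(** The choice is immaterial on conjugates of relators, by [conj_gen_eq]; all other elements get the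
    default value 1. *)
Definition crossed_value (x : F) : P :=
  xget 1 [set p | exists U i e,
    x = conj_relator R U i e /\ p = conj_gen U i e]%classic.

Lemma crossed_valueE U i e :
  crossed_value (conj_relator R U i e) = conj_gen U i e.
Proof.
rewrite /crossed_value; case: xgetP => [p _ /= [V [j [f [eqUV ->]]]]|].
  exact/esym/conj_gen_eq.
by move/(_ (conj_gen U i e)) => /= []; exists U, i, e.
Qed.

Lemma conj_genE U i e :
  conj_gen U i e = (if e then (T i)^-1 else T i) ^ (D U)^-1.
Proof. by rewrite conjgE invgK /conj_gen mulgA. Qed.

Lemma conj_genM V U i e : conj_gen (V * U) i e = conj_gen U i e ^ (D V)^-1.
Proof. by rewrite !conj_genE gmulfM invgM conjgM. Qed.

(* The relations say that [conj_gen V j f] and the element of [D] with the same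
   image in [F] act in the same way on the generators of the kernel. *)
Lemma conj_gen_commute U V i j e f :
  commute (conj_gen U i e)
          (conj_gen V j f * (D (conj_relator R V j f))^-1).
Proof.
have -> : conj_gen V j f * (D (conj_relator R V j f))^-1 =
    ((if f then (T j)^-1 else T j) * (D (signed f (rel j)))^-1) ^ (D V)^-1.
  rewrite conj_genE conj_relatorE gmulfJ [D V^-1]gmulfV.
  by rewrite -conjVg -conjMg.
rewrite conj_genE -[(D V)^-1](mulgK (D U)) conjgM; apply: commuteJ.
suff {e} : commute (T i) (((if f then (T j)^-1 else T j) *
    (D (signed f (rel j)))^-1) ^ ((D V)^-1 * D U)).
  by case: e => //= commT; apply/commute_sym/commuteV/commute_sym.
have := T_peiffer j i (V^-1 * U); rewrite gmulfM gmulfV.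
set g := _ * D U; rewrite -2!mulgA (mulgA (T j)^-1) -conjgE.
(* For [f] true this is [T_peiffer] itself. For [f] false it is its inverse with the two factors
   swapped, as [T j] commutes with [D (rel j)]. *)
case: f; rewrite /= ?gmulfV ?invgK // => /commuteV; rewrite -conjVg invgM invgK.
have /commuteV -> // : commute (T j) (D (rel j)).
exact/commute_sym/T_centralizer/commute_refl.
Qed.

(** The Peiffer identity of a crossed module: acting through the image in [F] is the same as
    conjugating in [P]. *)
Lemma conj_gen_peiffer U V i j e f :
  conj_gen ((conj_relator R V j f)^-1 * U) i e =
  conj_gen U i e ^ conj_gen V j f.
Proof.
rewrite conj_genM gmulfV invgK.
rewrite -[in RHS](mulgVK (D (conj_relator R V j f)) (conj_gen V j f)) conjgM.
congr (_ ^ _); apply/esym/eqP; rewrite conjg_fix.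
exact/commgP/conj_gen_commute.
Qed.

Lemma conj_genV U i e : (conj_gen U i e)^-1 = conj_gen U i (~~ e).
Proof.
by rewrite /conj_gen !invgM invgK mulgA; case: e => /=; rewrite ?invgK.
Qed.

Lemma conj_gen_cancel U V i j e f :
  conj_relator R U i e * conj_relator R V j f = 1 ->
  conj_gen U i e * conj_gen V j f = 1.
Proof.
move=> /mulg1_eq; rewrite conj_relatorV => /conj_gen_eq <-.
by rewrite -conj_genV mulgV.
Qed.

Lemma crossed_value_peiffer s s' : peiffer_step R s s' ->
  \prod_(x <- s) crossed_value x = \prod_(x <- s') crossed_value x.
Proof.
case=> [s1 s2 U i e V j f|s1 s2 U i e V j f /conj_gen_cancel eq1
       |s1 s2 U i e V j f /conj_gen_cancel eq1].
- rewrite !big_cat !big_cons /=; congr (_ * _).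
  (* The second new term is again a conjugate of a relator, and its value is [a ^ b] for the old
     values [a], [b]; then [b * a ^ b = a * b]. *)
  set x := (X in _ = _ * (crossed_value X * _)).
  have -> : x = conj_relator R ((conj_relator R V j f)^-1 * U) i e.
    rewrite conj_relatorV /x /conj_relator; congr (_ * _).
    by rewrite !invgM invgK !mulgA; case: (f); rewrite /= ?invgK.
  by rewrite !crossed_valueE conj_gen_peiffer mulgA
             (conjgC (conj_gen U i e)) -mulgA.
- rewrite !big_cat !big_cons !crossed_valueE /=; congr (_ * _).
  by rewrite mulgA eq1 mul1g.
- rewrite !big_cat !big_cons !crossed_valueE /=; congr (_ * _).
  by rewrite mulgA eq1 mul1g.
Qed.

Hypothesis R_aspherical : peiffer_aspherical R.

Lemma crossed_value_identity s : is_identity R s ->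
  \prod_(x <- s) crossed_value x = 1.
Proof.
suff prod_eq s' : clos_refl_trans _ (peiffer_step R) s s' ->
    \prod_(x <- s) crossed_value x = \prod_(x <- s') crossed_value x.
  by move=> /R_aspherical/prod_eq->; rewrite big_nil.
by elim=> {s s'} [s s' /crossed_value_peiffer|s|s s' s'' _ -> _ ->].
Qed.

(** Generation of [P] by the image of [D] and the [T i], in the form of an induction principle. *)
Hypothesis P_generated : forall Q : P -> Prop, Q 1 ->
  (forall x p, Q p -> Q (D x * p)) ->
  (forall i e p, Q p -> Q ((if e then (T i)^-1 else T i) * p)) ->
  forall p, Q p.

(** The splitting of [P] over [D]: a factor from [D] moves to the right past each [conj_gen],
    conjugating it into another one. *)
Lemma conj_gen_normal_form p : exists (L : seq (F * 'I_m * bool)) w,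
  p = \prod_(z <- L) conj_gen z.1.1 z.1.2 z.2 * D w.
Proof.
elim/P_generated: p => [|x p [L [w ->]]|i e p [L [w ->]]].
- by exists [::], 1; rewrite big_nil gmulf1 mulg1.
- exists [seq ((x * z.1.1, z.1.2), z.2) | z <- L], (x * w).
  rewrite gmulfM !mulgA; congr (_ * _); rewrite big_map /=.
  elim: L => [|z L IHL]; rewrite ?big_nil ?mulg1 ?mul1g // !big_cons /=.
  by rewrite -[RHS]mulgA -IHL conj_genM conjgE invgK !mulgA mulgVK.
- exists (((1, i), e) :: L), w; rewrite big_cons /= mulgA.
  by rewrite conj_genE gmulf1 invg1 conjg1.
Qed.

Variables p1 p2 : hom P F.
Hypotheses (p1D : forall x, p1 (D x) = x) (p1T : forall i, p1 (T i) = 1).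
Hypotheses (p2D : forall x, p2 (D x) = x) (p2T : forall i, p2 (T i) = rel i).

Lemma p1_conj_gen U i e : p1 (conj_gen U i e) = 1.
Proof.
by rewrite conj_genE gmulfJ; case: e; rewrite !gmulfV p1T ?invg1 conj1g.
Qed.

Lemma p2_conj_gen U i e : p2 (conj_gen U i e) = conj_relator R U i e.
Proof.
by rewrite /conj_gen !gmulfM gmulfV /= p2D; case: e; rewrite ?gmulfV p2T.
Qed.

(** In the normal form [p1] kills every [conj_gen], which forces [w = 1]. Then [p2] turns the
    product into an identity among relations, and [crossed_value] carries it back to [p]. *)
Lemma projections_trivial p : p1 p = 1 -> p2 p = 1 -> p = 1.
Proof.
have [L [w ->]] := conj_gen_normal_form p; rewrite !gmulfM p1D p2D.
have -> : p1 (\prod_(z <- L) conj_gen z.1.1 z.1.2 z.2) = 1.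
  by rewrite gmulf_prod big1 // => z _; apply: p1_conj_gen.
rewrite mul1g => ->; rewrite gmulf1 !mulg1 gmulf_prod => prodL1.
pose cr (z : F * 'I_m * bool) := conj_relator R z.1.1 z.1.2 z.2.
rewrite -[RHS](@crossed_value_identity (map cr L)); last first.
  split; last first.
    rewrite big_map -[RHS]prodL1.
    by apply: eq_bigr => z _; rewrite p2_conj_gen.
  by move=> _ /mapP[[[U i] e] _ ->]; exists U, i, e.
by rewrite big_map; apply: eq_bigr => z _; rewrite crossed_valueE.
Qed.

Lemma projections_surjective w1 w2 : eq_in_group R w1 w2 ->
  exists p, p1 p = w1 /\ p2 p = w2.
Proof.
move=> /eqP/pres_classP cl_w.
have [p [p1p p2p]] : exists p, p1 p = 1 /\ p2 p = w1^-1 * w2.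
  (* The image under [p2] of the kernel of [p1] is a normal subgroup containing the relators. *)
  apply: (cl_w [set x | exists p, p1 p = 1 /\ p2 p = x]%classic).
  split; last by move=> _ [i _ <-]; exists (T i).
  split; first split => /=.
  - by exists 1; rewrite !gmulf1.
  - move=> _ _ [p [p1p <-]] [q [p1q <-]]; exists (p * q).
    by rewrite !gmulfM p1p p1q mulg1.
  - by move=> _ [p [p1p <-]]; exists p^-1; rewrite !gmulfV p1p invg1.
  - move=> _ g [p [p1p <-]]; exists (p ^ D g).
    by rewrite !gmulfJ p2D p1p conj1g.
by exists (D w1 * p); rewrite !gmulfM p1D p2D p1p p2p mulg1 mulVKg.
Qed.

End CrossedModule.

(** * The copy of the free group on the [d_ m k], and roots inside it *)

Lemma generated_subgroup (G : groupType) (S : set G) : subgroup (generated S).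
Proof.
split=> [|x y gx gy|x gx] N SN; have [[N1 NM NV] _] := SN.
- exact: N1.
- exact: NM (gx N SN) (gy N SN).
- exact: NV (gx N SN).
Qed.

Section DiagonalCopy.
Variables (n m : nat) (R : 'I_m -> word 'I_n).
Local Notation F := (free_group 'I_n).
Local Notation E := (free_group ('I_n + 'I_m)%type).

Variable iota : hom F E.
Hypothesis iotaE : forall k, iota (free_gen k) = d_ m k.

Lemma D_imageP e : D_ (m := m) e <-> exists x, e = iota x.
Proof.
split=> [|[x ->]].
  move=> De; apply: (De [set e | exists x, e = iota x]%classic).
  split; last by move=> _ [k _ <-]; exists (free_gen k).
  split; first by exists 1; rewrite gmulf1.
    by move=> _ _ [x ->] [y ->]; exists (x * y); rewrite gmulfM.
  by move=> _ [x ->]; exists x^-1; rewrite gmulfV.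
have [D1 DM DV] := @generated_subgroup E (range (@d_ n m)).
have Dgen (k : 'I_n) : D_ (d_ m k) by move=> N [_]; apply; exists k.
elim/free_group_ind: x => [|k x Dx|k x Dx].
- by rewrite gmulf1; exact: D1.
- by rewrite gmulfM iotaE; exact: DM (Dgen k) Dx.
- by rewrite gmulfM gmulfV iotaE; exact: DM (DV _ (Dgen k)) Dx.
Qed.

Lemma r_image i : r_ R i = iota (relator R i).
Proof.
rewrite /r_ /relator; elim: (R i) => [|[k b] w IHw] /=; first by rewrite gmulf1.
rewrite -cat1s -[in RHS]cat1s !free_of_word_cat IHw gmulfM; congr (_ * _).
case: b; last by rewrite iotaE.
rewrite -[[:: (k, true)]]/(inv_word [:: (k, false)]) free_of_word_inv gmulfV.
by rewrite iotaE -free_of_word_inv.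
Qed.

Lemma iotaK (q : hom E F) :
  (forall k, q (d_ m k) = free_gen k) -> cancel iota q.
Proof.
move=> qE x; elim/free_group_ind: x => [|k x IHx|k x IHx].
- by rewrite !gmulf1.
- by rewrite !gmulfM IHx iotaE qE.
- by rewrite !gmulfM IHx !gmulfV iotaE qE.
Qed.

Lemma iota_inj : injective iota.
Proof.
(* Sending every [t_ n i] to 1 gives a retraction. *)
have [q qE] := free_universal
  (fun a : 'I_n + 'I_m => if a is inl k then free_gen k else 1).
by apply: can_inj (iotaK (q := q) _) => k; rewrite qE.
Qed.

(** A root in [F] maps to a root in [D_], so the choice in [root_of] does not fall back on its
    default. The chosen root pulls back because [iota] is injective with image [D_]. *)
Lemma root_of_r i : relator R i != 1 ->
  exists s k, [/\ root_of (r_ R i) = iota s, relator R i = s ^+ k.+1 &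
                  indivisible s].
Proof.
move=> /primitive_root_exists[s [k [relE ind_s]]].
have root_s : is_root (r_ R i) (iota s).
  split; first by apply/D_imageP; exists s.
    by exists k; rewrite r_image relE gmulfXn.
  move=> [_ [j [/D_imageP[u ->] j_gt1]]]; rewrite -gmulfXn => /iota_inj sE.
  by apply: ind_s; exists u, j.
have [] := xgetPex 1 (ex_intro _ _ root_s).
rewrite -/(root_of _) => /D_imageP[s' rootE] [k' rE] indiv.
exists s', k'; split=> //.
  by apply: iota_inj; rewrite -r_image rE rootE gmulfXn.
move=> [u [j [j_gt1 sE]]]; apply: indiv; exists (iota u), j; split=> //.
  by apply/D_imageP; exists u.
by rewrite rootE sE gmulfXn.
Qed.

End DiagonalCopy.

(** * Construction of the isomorphism *)

Local Notation pc := (pres_class (mihailova_relators _)) (only parsing).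

Theorem theorem1p1 (n m : nat) (R : 'I_m -> word 'I_n) :
  (2 <= n)%N -> concise R -> peiffer_aspherical R ->
  exists f : {multiplicative mihailova_presented R -> mihailova R},
    [/\ bijective f,
        forall k : 'I_n,
          val (f (pres_class (mihailova_relators R) (d_ m k))) =
          (free_gen k, free_gen k) &
        forall i : 'I_m,
          val (f (pres_class (mihailova_relators R) (t_ n i))) =
          (1, relator R i)].
Proof.
move=> _ R_concise R_aspherical.
have rel_neq1 := relator_neq1 R_concise.
have [iota iotaE] := free_universal (@d_ n m).
(* The two coordinates of the assignment on generators. *)
pose h1 (a : 'I_n + 'I_m) := if a is inl k then free_gen k else 1.
pose h2 (a : 'I_n + 'I_m) :=
  match a with inl k => free_gen k | inr i => relator R i end.
have [q1 q1E] := free_universal h1; have [q2 q2E] := free_universal h2.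
have q1_iota : cancel iota q1 by apply: iotaK => // k; rewrite q1E.
have q2_iota : cancel iota q2 by apply: iotaK => // k; rewrite q2E.
have q1t i : q1 (t_ n i) = 1 by rewrite q1E.
have q2t i : q2 (t_ n i) = relator R i by rewrite q2E.
have q1_rel e : mihailova_relators R e -> q1 e = 1.
  case=> [[i [j [d [_ ->]]]]|[i ->]]; rewrite gmulfR q1t comm1g //.
have q2_rel e : mihailova_relators R e -> q2 e = 1.
  case=> [[i [j [d [_ ->]]]]|[i ->]].
    (* Both [t_ n i] and [r_ R i] map to [relator R i], so the second entry of the commutator
       becomes 1. *)
    rewrite gmulfR !gmulfM !gmulfV /= !q2t (r_image R iotaE) q2_iota.
    by rewrite mulgVK mulVg commg1.
  have [s [k [-> relE _]]] := root_of_r iotaE (rel_neq1 i).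
  rewrite gmulfR /= q2t q2_iota; apply/eqP/commgP; rewrite /= relE.
  exact/commute_sym/commuteX/commute_refl.
have [p1 p1E] := pres_universal q1_rel; have [p2 p2E] := pres_universal q2_rel.
pose D : hom (free_group 'I_n) (mihailova_presented R) := pc \o iota.
pose T i : mihailova_presented R := pc (t_ n i).
have D_gen k : D (free_gen k) = pc (d_ m k) by rewrite -iotaE.
have p1D x : p1 (D x) = x by rewrite p1E q1_iota.
have p2D x : p2 (D x) = x by rewrite p2E q2_iota.
have p1T i : p1 (T i) = 1 by rewrite p1E q1t.
have p2T i : p2 (T i) = relator R i by rewrite p2E q2t.
have T_peiffer i j x :
    commute (T j) ((D x)^-1 * (T i)^-1 * D (relator R i) * D x).
  have -> : (D x)^-1 * (T i)^-1 * D (relator R i) * D x =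
      pc ((iota x)^-1 * (t_ n i)^-1 * r_ R i * iota x).
    by rewrite !gmulfM !gmulfV (r_image R iotaE).
  apply/commgP/eqP; rewrite -gmulfR; apply: pres_class_eq1.
  by left; exists i, j, (iota x); split=> //; apply/(D_imageP iotaE); exists x.
have T_centralizer i x : commute x (relator R i) -> commute (D x) (T i).
  have [s [k [rootE relE ind_s]]] := root_of_r iotaE (rel_neq1 i).
  have comm_s : commute (D s) (T i).
    apply/commute_sym/commgP/eqP; rewrite -gmulfR; apply: pres_class_eq1.
    by right; exists i; rewrite rootE.
  (* Whatever commutes with the relator is a power of its root, so the single relator with the root
     suffices. *)
  move=> /(centralizer_primitive_root (rel_neq1 i) relE ind_s)[j xE].
  have comm_sj : commute (T i) (D s ^+ j) by apply/commuteX/commute_sym.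
  by case: xE => ->; rewrite ?gmulfV gmulfXn; apply: commute_sym => //;
     apply: commuteV.
have P_generated (Q : mihailova_presented R -> Prop) : Q 1 ->
    (forall x p, Q p -> Q (D x * p)) ->
    (forall i e p, Q p -> Q ((if e then (T i)^-1 else T i) * p)) ->
    forall p, Q p.
  move=> Q1 QD QT p; rewrite -(pres_classK p).
  elim/free_group_ind: (repr p) => [|[k|i] x Qx|[k|i] x Qx] //.
  - by rewrite gmulfM; have := QD (free_gen k) _ Qx; rewrite D_gen.
  - by rewrite gmulfM; apply: (QT i false).
  - rewrite gmulfM gmulfV; have := QD (free_gen k)^-1 _ Qx.
    by rewrite gmulfV D_gen.
  - by rewrite gmulfM gmulfV; apply: (QT i true).
have mih p : in_mihailova R (p1 p, p2 p).
  apply/eqP; elim/P_generated: p => [|x p /= IHp|i e p /= IHp] /=.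
  - by rewrite !gmulf1.
  - by rewrite !gmulfM /= p1D p2D IHp.
  have relT1 : pres_class (range (relator R)) (relator R i) = 1.
    by apply: pres_class_eq1; exists i.
  rewrite !gmulfM /= IHp; congr (_ * _).
  case: e; last by rewrite p1T p2T relT1 gmulf1.
  by rewrite !gmulfV /= p1T p2T relT1 gmulf1.
pose f p : mihailova R := exist _ (p1 p, p2 p) (mih p).
have fM : {morph f : p q / p * q}.
  by move=> p q; apply: val_inj; rewrite /= !gmulfM.
pose fm := isMultiplicative.Build _ _ f fM.
pose f' : {multiplicative mihailova_presented R -> mihailova R} := HB.pack f fm.
exists f'; split=> [|k|i]; first last.
- by rewrite /= p1T p2T.
- by rewrite /= p1E p2E q1E q2E.
have surj (w : mihailova R) : exists p, f p = w.
  have [p [p1p p2p]] := projections_surjective p1D p1T p2D p2T (valP w).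
  by exists p; apply: val_inj; rewrite /= p1p p2p -surjective_pairing.
(* A right inverse [g] of [f] is also a left one: both projections of [g (f p) / p] are trivial. *)
have [g gK] := choice surj.
exists g => // p; apply/divg1_eq.
have [] : (f (g (f p))) = f p by apply: gK.
move=> p1gp p2gp.
by apply: (projections_trivial R_concise T_peiffer T_centralizer R_aspherical
             P_generated p1D p1T p2D p2T); rewrite gmulfF ?p1gp ?p2gp mulgV.
Qed.
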